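(* Let $G$ be a bipartite multigraph (multiple edges allowed, no loops) with maximum degree $\Delta(G)$, and let the palette be $\mathcal{K}=\{1,\dots,\Delta(G)+1\}$. Let $M\subseteq E(G)$ be a matching whose edges are assigned arbitrary colours from $\mathcal{K}$. Then this precolouring can be extended to a proper edge-colouring of all of $G$ using only colours from $\mathcal{K}$.
   Context: A proper edge-colouring assigns colours to edges so that any two edges sharing an end-vertex (including parallel edges) receive distinct colours. Extending a precolouring means producing a proper edge-colouring of all of $G$ agreeing with the given colours on the precoloured edges. *)

(* Defs.v *)
From mathcomp Require Import all_boot.

Set Implicit Arguments.
Unset Strict Implicit.
Unset Printing Implicit Defensive.

(* Edges form a type of their own, so that distinct edges may have the same
   set of ends; [card_ends] excludes loops. *)
Record multigraph := Multigraph {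
  vertex : finType;
  edge : finType;
  ends : edge -> {set vertex};
  card_ends : forall e, #|ends e| = 2
}.

Section Defs.

Variable G : multigraph.
Implicit Types (v : vertex G) (e f : edge G) (M : {set edge G}).

Definition degree v : nat := #|[set e | v \in ends e]|.

Definition max_degree : nat := \max_(v : vertex G) degree v.

Definition bipartite : Prop :=
  exists A : {set vertex G}, forall e,
    exists u v, [/\ u \in A, v \notin A & ends e = [set u; v]].

Definition share_end e f : Prop := exists2 v, v \in ends e & v \in ends f.

Definition matching M : Prop :=
  forall e f, e \in M -> f \in M -> e <> f -> ~ share_end e f.

Definition proper_edge_colouring (K : Type) (c : edge G -> K) : Prop :=
  forall e f, e <> f -> share_end e f -> c e <> c f.

End Defs.

(* Main.v *)
Require Import Defs.
From mathcomp Require Import all_boot.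
From mathcomp Require Import zify.

(** Let D be the maximum degree. Give every edge outside M the list of the D+1
    colours not used by the at most two edges of M it touches. By Galvin's
    kernel argument it suffices to order the edges at each vertex so that each
    edge e outside M is preceded, at its two ends together, by fewer edges than
    its list has colours; it is enough that this number of edges be at most D
    minus the number of ends of e covered by M. By König's theorem G - M has a
    matching P meeting every vertex of degree D and whose edges all have an end
    not covered by M. Colour G - M - P with D-1 colours and order its edges
    increasingly on one side and decreasingly on the other, so that each is
    preceded by at most D-2 edges; then insert each edge of P first at an end
    not covered by M and last at its other end. *)

Set Implicit Arguments.
Unset Strict Implicit.
Unset Printing Implicit Defensive.

(** * Pigeonhole counts for integer labels *)

Section Counting.

Variable E : finType.
Implicit Types (X : {set E}) (r : E -> nat).

Lemma card_le_range X r m n :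
  {in X &, injective r} -> {in X, forall e, m <= r e < n} -> #|X| <= n - m.
Proof.
move=> rI rX; rewrite -[n - m](size_iota m) cardE -(size_map r).
apply: uniq_leq_size.
  rewrite map_inj_in_uniq ?enum_uniq // => e f.
  by rewrite !mem_enum; apply: rI.
move=> y /mapP[e]; rewrite mem_enum => /rX rE ->.
by rewrite mem_iota; lia.
Qed.

Lemma unused_value X r k :
  #|X| < k -> exists2 x, x < k & {in X, forall e, r e != x}.
Proof.
move=> Xk.
have [/hasP[x]|/hasPn allX] :=
  boolP (has (fun x => x \notin [seq r e | e in X]) (iota 0 k)).
  rewrite mem_iota /= add0n => xk xX; exists x => // e eX.
  by apply: contraNneq xX => <-; apply: image_f.
have: size (iota 0 k) <= size [seq r e | e in X].
  apply: uniq_leq_size; first exact: iota_uniq.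
  by move=> x /allX; rewrite negbK.
by rewrite size_iota size_image; lia.
Qed.

End Counting.

Definition swap (x y z : nat) := if z == x then y else if z == y then x else z.

Lemma swap_inj x y : injective (swap x y).
Proof. by move=> z t; rewrite /swap; do !case: ifP; lia. Qed.

(** * Bipartite multigraphs presented by their two end maps *)

Section EndMaps.

Variables (E : finType) (U V : eqType) (a : E -> U) (b : E -> V).
Implicit Types (e f g : E) (F : {set E}).

Definition adj e f := (e != f) && ((a e == a f) || (b e == b f)).

Definition proper_on (K : eqType) (c : E -> K) F :=
  {in F &, forall e f, adj e f -> c e != c f}.

Definition star (W : eqType) (h : E -> W) F (w : W) := [set f in F | h f == w].

Lemma adj_sym e f : adj e f = adj f e.
Proof. by rewrite /adj eq_sym (eq_sym (a e)) (eq_sym (b e)). Qed.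

Lemma proper_on_eqa (K : eqType) (c : E -> K) F e f : proper_on c F ->
  e \in F -> f \in F -> a e = a f -> c e = c f -> e = f.
Proof.
move=> cP eF fF aE cE; apply/eqP; apply: contraT => ef.
by have := cP e f eF fF; rewrite /adj ef aE eqxx cE eqxx => /(_ isT).
Qed.

Lemma proper_on_eqb (K : eqType) (c : E -> K) F e f : proper_on c F ->
  e \in F -> f \in F -> b e = b f -> c e = c f -> e = f.
Proof.
move=> cP eF fF bE cE; apply/eqP; apply: contraT => ef.
by have := cP e f eF fF; rewrite /adj ef bE eqxx orbT cE eqxx => /(_ isT).
Qed.

(* The [x]/[y]-alternating trail leaving [v] through an [x]-edge always enters
   a [U]-vertex through an [x]-edge, so it never meets [u]. *)
Lemma kempe_exchange (c : E -> nat) F (u : U) (v : V) x y :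
    proper_on c F -> {in F, forall f, a f = u -> c f != x} ->
    {in F, forall f, b f = v -> c f != y} ->
  exists c', [/\ proper_on c' F,
    {in F, forall f, c' f \in [:: c f; x; y]} &
    {in F, forall f, a f = u \/ b f = v -> c' f != x}].
Proof.
move=> cP ux vy.
have [xy|xy] := eqVneq x y.
  exists c; split=> // [f _|f fF]; first by rewrite inE eqxx.
  by case=> [/(ux f fF)|/(vy f fF)]; rewrite // xy.
(* [r] directs the trail: from an [x]-edge to the [y]-edge at the same [U]-vertex, from a [y]-edge
   to the [x]-edge at the same [V]-vertex. [D] is the set of edges reached from [v]; by [DP] each of
   them starts the trail or has a predecessor in it. *)
pose r e f := [&& e \in F, f \in F &
  [&& c e == x, c f == y & a e == a f] || [&& c e == y, c f == x & b e == b f]].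
pose D := [set f | [exists e0 in F, [&& b e0 == v, c e0 == x & connect r e0 f]]].
have D0 f : f \in F -> b f = v -> c f = x -> f \in D.
  move=> fF bf cf; rewrite inE; apply/existsP; exists f.
  by rewrite fF bf cf !eqxx connect0.
have DS e f : e \in D -> r e f -> f \in D.
  rewrite !inE => /existsP[e0 /and4P[e0F be0 ce0 con]] ref; apply/existsP.
  exists e0; rewrite e0F be0 ce0 /=; exact: connect_trans con (connect1 ref).
have DP f : f \in D ->
    [/\ f \in F, b f = v & c f = x] \/ exists2 e, e \in D & r e f.
  rewrite inE => /existsP[e0 /and4P[e0F /eqP be0 /eqP ce0]] /connectP[p].
  elim/last_ind: p => [|p g _] /=; first by move=> _ ->; left.
  rewrite rcons_path last_rcons => /andP[pth rg] ->; right.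
  exists (last e0 p) => //; rewrite inE; apply/existsP; exists e0.
  by rewrite e0F be0 ce0 !eqxx /=; apply/connectP; exists p.
have DC f : f \in D -> c f = x \/ c f = y.
  by case/DP => [[]|[e _ /and3P[_ _ /orP[]/and3P[_ /eqP-> _]]]]; auto.
have DF f : f \in D -> f \in F.
  by case/DP => [[]|[e _ /and3P[_ ->]]].
(* A neighbour of [e] coloured [x] or [y] is its successor or, by properness, its predecessor; the
   first edge has no [y]-neighbour at [v]. Swapping on [D] thus creates no conflict with edges
   outside [D]. *)
have Dclosed e f : e \in D -> f \in F -> adj e f -> c f \in [:: x; y] -> f \in D.
  move=> eD fF ef; have eF := DF _ eD; have cef := cP _ _ eF fF ef.
  rewrite mem_seq2 => /orP[]/eqP cf; case: (DC _ eD) => ce; move: cef;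
    rewrite ce cf ?eqxx // => cef; case/andP: ef => _ /orP[]/eqP ef.
  - case: (DP _ eD) => [[_ _]|[g gD /and3P[gF _ /orP[]/and3P[/eqP cg]]]].
    + by rewrite ce => yx; rewrite yx eqxx in cef.
    + move=> _ /eqP ag; have <- // : g = f.
      by apply: (proper_on_eqa cP) => //; rewrite ?cg ?cf // ag.
    + by rewrite ce (negPf cef).
  - by apply: DS eD _; rewrite /r eF fF ce cf ef !eqxx orbT.
  - by apply: DS eD _; rewrite /r eF fF ce cf ef !eqxx.
  - case: (DP _ eD) => [[_ be _]|[g gD /and3P[gF _ /orP[]/and3P[/eqP cg]]]].
    + by have := vy _ fF; rewrite -ef be cf eqxx => /(_ erefl).
    + by rewrite ce (negPf cef).
    + move=> _ /eqP bg; have <- // : g = f.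
      by apply: (proper_on_eqb cP) => //; rewrite ?cg ?cf // bg.
pose c' f := if f \in D then swap x y (c f) else c f.
have mixed e f : e \in D -> f \in F -> f \notin D -> adj e f -> c' e != c' f.
  move=> eD fF fD ef.
  have /[!inE] : c f \notin [:: x; y] by apply: contra fD; apply: Dclosed ef.
  rewrite /c' eD (negPf fD) /swap negb_or => /andP[fx fy].
  by case: (DC _ eD) => ->; rewrite !eqxx ?if_same eq_sym //; case: ifP.
exists c'; split.
- move=> e f eF fF ef; have [eD|eD] := boolP (e \in D); have [fD|fD] := boolP (f \in D).
  + rewrite /c' eD fD; apply: contraTneq (cP _ _ eF fF ef) => /swap_inj ->.
    by rewrite eqxx.
  + exact: mixed.
  + by rewrite eq_sym; apply: mixed; rewrite // adj_sym.
  + by rewrite /c' (negPf eD) (negPf fD); apply: cP.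
- move=> f fF; rewrite /c' /swap !inE.
  by case: ifP; rewrite ?eqxx //; do 2 (case: ifP; rewrite ?eqxx ?orbT //).
move=> f fF; rewrite /c' /swap; case: ifP => [fD|/negbT fD].
  case: (DC _ fD) => cf; rewrite cf eqxx; first by rewrite eq_sym.
  rewrite (eq_sym y) (negPf xy) => -[af|bf]; last first.
    by have := vy _ fF bf; rewrite cf eqxx.
  (* A [y]-edge of [D] at [u] would have an [x]-edge at [u] as predecessor. *)
  case: (DP _ fD) => [[_ _]|[g gD /and3P[gF _ /orP[]/and3P[/eqP cg]]]].
  - by rewrite cf => /esym/eqP; rewrite (negPf xy).
  - by move=> _ /eqP ag; have := ux _ gF; rewrite ag cg eqxx => /(_ af).
  - by rewrite cf eq_sym (negPf xy).
case=> [af|bf]; first exact: ux.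
by apply: contra fD => /eqP cf; apply: D0.
Qed.

(** Induction on the number of edges: once [e] is removed, each end of [e] misses one of the [k]
    colours, and a Kempe exchange makes the same colour [x] free at both ends, so [e] can receive
    it. *)
Lemma konig_edge_colouring k F :
    {in F, forall e, #|star a F (a e)| <= k} ->
    {in F, forall e, #|star b F (b e)| <= k} ->
  exists2 c : E -> nat, proper_on c F & {in F, forall e, c e < k}.
Proof.
have [n] := ubnP #|F|; elim: n F => // n IH F Fn aF bF.
have [->|[e eF]] := set_0Vmem F; first by exists (fun=> 0) => e; rewrite inE.
have starD (W : eqType) (h : E -> W) : {in F, forall f, #|star h F (h f)| <= k} ->
    {in F :\ e, forall f, #|star h (F :\ e) (h f)| <= k}
    /\ #|star h (F :\ e) (h e)| < k.
  move=> hF; split=> [f|].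
    rewrite !inE => /andP[_ fF]; apply: leq_trans (hF f fF).
    by apply/subset_leq_card/subsetP => g; rewrite !inE => /andP[/andP[_ ->]].
  apply: leq_trans (hF e eF).
  rewrite (cardsD1 e (star h F (h e))) inE eF eqxx add1n ltnS.
  by apply/subset_leq_card/subsetP => g; rewrite !inE -andbA.
have [aF' ak] := starD _ _ aF; have [bF' bk] := starD _ _ bF.
have [|c cP ck] := IH (F :\ e) _ aF' bF'.
  by move: Fn; rewrite (cardsD1 e) eF; lia.
have [x xk cx] := unused_value c ak; have [y yk cy] := unused_value c bk.
have [||c' [c'P c'c c'x]] := @kempe_exchange c (F :\ e) (a e) (b e) x y cP.
- by move=> f fF af; apply: cx; rewrite inE fF af eqxx.
- by move=> f fF bf; apply: cy; rewrite inE fF bf eqxx.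
have new f : f \in F -> adj e f -> x != c' f.
  move=> fF /andP[ef /orP ends]; rewrite eq_sym; apply: c'x.
    by rewrite !inE eq_sym ef.
  by case: ends => /eqP ->; [left | right].
exists (fun f => if f == e then x else c' f) => [f g fF gF|f fF].
  have [->|fe] := eqVneq f e; have [->|ge] := eqVneq g e.
  - by rewrite /adj eqxx.
  - exact: new.
  - by rewrite adj_sym eq_sym; apply: new.
  - by apply: c'P; rewrite !inE ?fe ?ge.
have [_|fe] := eqVneq f e; first by [].
have fF' : f \in F :\ e by rewrite !inE fe.
by have := c'c f fF'; rewrite !inE => /or3P[]/eqP-> //; apply: ck.
Qed.

(** * Stable matchings and Galvin's list colouring *)

Section Preferences.

Variables ra rb : E -> nat.

(** Galvin's orientation of the line graph: a smaller rank is preferred. *)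
Definition dominates f e :=
  (a f == a e) && (ra f < ra e) || (b f == b e) && (rb f < rb e).

Definition strict_on F :=
  {in F &, forall e f, a e = a f -> ra e = ra f -> e = f} /\
  {in F &, forall e f, b e = b f -> rb e = rb f -> e = f}.

Lemma strict_onS F F' : F' \subset F -> strict_on F -> strict_on F'.
Proof.
by move=> /subsetP sF [sa sb]; split=> e f /sF eF /sF; [apply: sa | apply: sb].
Qed.

(** Gale-Shapley by deletion. If two first choices [e], [f] of [U]-vertices meet in [V], the one
    ranked worse there, [f], is deleted: either [e] is kept and dominates [f], or what dominates [e]
    does so at the [V]-end and hence dominates [f] too. Without such conflicts the first choices
    form the kernel. *)
Lemma stable_matching F : strict_on F -> exists N : {set E},
  [/\ N \subset F, {in N &, forall e f, ~~ adj e f} &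
      {in F, forall e, e \notin N -> exists2 f, f \in N & dominates f e}].
Proof.
have [n] := ubnP #|F|; elim: n F => // n IH F Fn sF; have [sa sb] := sF.
pose top f := [forall g in F, (a g == a f) ==> (ra f <= ra g)].
have topP f g : top f -> g \in F -> a g = a f -> ra f <= ra g.
  by move=> /forall_inP/(_ g) fT /fT /implyP le_fg ag; apply: le_fg; rewrite ag.
have [/existsP[e /existsP[f /and5P[/andP[eF fF] eT fT /eqP bef rbef]]]|noconf] :=
  boolP [exists e, exists f, [&& (e \in F) && (f \in F), top e, top f,
                                 b e == b f & rb e < rb f]].
  have [||N [NF Nm Nd]] := IH (F :\ f).
  - by move: Fn; rewrite (cardsD1 f) fF; lia.
  - exact: strict_onS (subsetDl _ _) sF.
  exists N; split=> // [|g gF gN]; first exact: subset_trans NF (subsetDl _ _).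
  have [->|gf] := eqVneq g f; last by apply: Nd; rewrite // !inE gf.
  have [eN|eN] := boolP (e \in N).
    by exists e; rewrite // /dominates bef eqxx rbef orbT.
  have [|h hN /orP[/andP[/eqP ah]|/andP[/eqP bh rbh]]] := Nd e _ eN.
  - by rewrite !inE eF andbT; apply: contraTneq rbef => ->; rewrite ltnn.
  - have/setD1P[_ hF] := subsetP NF _ hN.
    by rewrite ltnNge topP.
  - exists h => //; rewrite /dominates bh bef eqxx (ltn_trans rbh rbef).
    by rewrite orbT.
exists [set f in F | top f]; split=> [|e f|e eF].
- by apply/subsetP => f; rewrite inE => /andP[].
- rewrite !inE => /andP[eF eT] /andP[fF fT].
  apply/negP => /andP[/eqP ef /orP[]/eqP].
    by move=> aef; apply: ef; apply: sa => //; apply/eqP; rewrite eqn_leq !topP.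
  move=> bef; have [rlt|rlt|/sb] := ltngtP (rb e) (rb f); last by auto.
    case/negP: noconf; apply/existsP; exists e; apply/existsP; exists f.
    by rewrite eF fF eT fT bef eqxx rlt.
  case/negP: noconf; apply/existsP; exists f; apply/existsP; exists e.
  by rewrite eF fF eT fT bef eqxx rlt.
rewrite inE eF /= => eT.
(* The first choice at the [U]-end of [e] dominates [e]. *)
case: (@arg_minnP _ e (fun f => (f \in F) && (a f == a e)) ra); first by rewrite eF eqxx.
move=> f /andP[fF /eqP af] fmin.
have fT : top f.
  apply/forall_inP => g gF; apply/implyP => /eqP ag.
  by apply: fmin; rewrite gF ag af eqxx.
exists f; first by rewrite inE fF.
rewrite /dominates af eqxx /= ltnNge; apply/orP; left; apply: contra eT => le_ef.
apply/forall_inP => g gF; apply/implyP => /eqP ag.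
by apply: leq_trans le_ef _; apply: fmin; rewrite gF ag eqxx.
Qed.

(* Galvin's argument: a stable matching of the edges whose list contains [k]
   can receive [k], and every other such edge loses one dominating edge. *)
Lemma list_colouring (K : finType) (k0 : K) F (L : E -> {set K}) :
    strict_on F ->
    {in F, forall e, #|[set f in F | dominates f e]| < #|L e|} ->
  exists2 c : E -> K, proper_on c F & {in F, forall e, c e \in L e}.
Proof.
have [n] := ubnP #|F|; elim: n F L => // n IH F L Fn sF dL.
have [->|[e eF]] := set_0Vmem F; first by exists (fun=> k0) => e; rewrite inE.
have [L0|[k kL]] := set_0Vmem (L e); first by have := dL e eF; rewrite L0 cards0.
have sFk : [set f in F | k \in L f] \subset F.
  by apply/subsetP => f; rewrite inE => /andP[].
have [N [NF Nm Nd]] := stable_matching (strict_onS sFk sF).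
have NP f : f \in N -> (f \in F) && (k \in L f).
  by move=> /(subsetP NF); rewrite inE.
have [g gN] : exists g, g \in N.
  have [eN|/Nd[]] := boolP (e \in N); first by exists e.
    by rewrite inE eF.
  by move=> g gN _; exists g.
have [|||c cP cL] := IH (F :\: N) (fun f => L f :\ k).
- apply: leq_trans (_ : #|F| <= n); last by move: Fn; lia.
  apply/proper_card/properP; split; first exact: subsetDl.
  by have/andP[gF _] := NP g gN; exists g; rewrite // inE gN.
- exact: strict_onS (subsetDl _ _) sF.
- move=> f /setDP[fF fN]; have := dL f fF; rewrite (cardsD1 k (L f)).
  have sub : [set h in F :\: N | dominates h f] \subset [set h in F | dominates h f].
    by apply/subsetP => h; rewrite !inE => /andP[/andP[_ ->]].
  have [kf|kf] := boolP (k \in L f); last first.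
    by move=> /(leq_ltn_trans (subset_leq_card sub)).
  have [|h hN hf] := Nd f _ fN; first by rewrite inE fF.
  rewrite add1n ltnS; apply: leq_trans; apply/proper_card/properP; split=> //.
  by have/andP[hF _] := NP h hN; exists h; rewrite !inE ?hF ?hN.
have new h : h \in F -> h \notin N -> k != c h.
  move=> hF hN; have := cL h; rewrite !inE hF hN => /(_ isT) /andP[].
  by rewrite eq_sym.
exists (fun f => if f \in N then k else c f) => [f h fF hF fh|f fF].
  have [fN|fN] := boolP (f \in N); have [hN|hN] := boolP (h \in N).
  - by have := Nm f h fN hN; rewrite fh.
  - exact: new.
  - by rewrite eq_sym; apply: new.
  - by apply: cP; rewrite // inE ?fN ?hN.
have [/NP/andP[]//|fN] := boolP (f \in N).
by have := cL f; rewrite !inE fN fF => /(_ isT)/andP[].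
Qed.

End Preferences.

(** * Extension of a precoloured matching *)

Lemma card_starID (W : eqType) (h : E -> W) F F' w :
  #|star h F w| = #|star h (F :&: F') w| + #|star h (F :\: F') w|.
Proof.
rewrite -(cardsID F' (star h F w)); congr (_ + _); apply: eq_card => e.
  by rewrite !inE andbAC.
by rewrite !inE andbA.
Qed.

Lemma mem_star (W : eqType) (h : E -> W) F e : e \in F -> e \in star h F (h e).
Proof. by move=> eF; rewrite inE eF eqxx. Qed.

(** A vertex with as many edges as there are colours sees every colour, so colour class [0] meets
    all vertices of full degree. *)
Lemma card_star_full (W : eqType) (h : E -> W) F w k (c : E -> nat) :
    {in F &, forall e f, h e = h f -> c e = c f -> e = f} ->
    {in F, forall e, c e < k.+1} -> k < #|star h F w| ->
  exists2 e, e \in star h F w & c e = 0.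
Proof.
move=> cI ck kF.
have [/exists_inP[e eS /eqP ce]|no0] := boolP [exists e in star h F w, c e == 0].
  by exists e.
suff: #|star h F w| <= k.+1 - 1 by lia.
apply: (@card_le_range _ _ c) => [e f|e eS].
  rewrite !inE => /andP[eF /eqP he] /andP[fF /eqP hf].
  by apply: cI => //; rewrite he hf.
have eF : e \in F by move: eS; rewrite inE => /andP[].
rewrite ck // andbT lt0n; apply: contra no0 => ce.
by apply/exists_inP; exists e.
Qed.

Lemma matching_extension_endmaps D (M : {set E}) (p : E -> 'I_D.+1) :
    (forall e, #|star a setT (a e)| <= D) ->
    (forall e, #|star b setT (b e)| <= D) ->
    {in M &, forall e f, ~~ adj e f} ->
  exists2 c : E -> 'I_D.+1, proper_on c setT & {in M, c =1 p}.
Proof.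
move=> aD bD MP.
pose H := ~: M.
pose cova e := #|star a M (a e)|; pose covb e := #|star b M (b e)|.
have covaH e : cova e + #|star a H (a e)| <= D.
  by have := aD e; rewrite (card_starID _ _ M) setTI setTD.
have covbH e : covb e + #|star b H (b e)| <= D.
  by have := bD e; rewrite (card_starID _ _ M) setTI setTD.
have [|| c1 c1P c1D] := @konig_edge_colouring D H.
- by move=> e _; have := covaH e; lia.
- by move=> e _; have := covbH e; lia.
(* A vertex with [D] edges in [H] is missed by [M], so the edge of colour [0] there has an uncovered
   end and survives in [P]. *)
pose P := [set e in H | (c1 e == 0) && ((cova e == 0) || (covb e == 0))].
have PP e : e \in P -> [/\ e \in H, c1 e = 0 & cova e = 0 \/ covb e = 0].
  by rewrite inE => /and3P[eH /eqP ? /orP[]/eqP ?]; split; auto.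
have Pa e f : e \in P -> f \in P -> a e = a f -> e = f.
  move=> /PP[eH ce _] /PP[fH cf _] af.
  by apply: (proper_on_eqa c1P); rewrite // ce cf.
have Pb e f : e \in P -> f \in P -> b e = b f -> e = f.
  move=> /PP[eH ce _] /PP[fH cf _] bf.
  by apply: (proper_on_eqb c1P); rewrite // ce cf.
(* One edge is saved at each vertex: by [M] if it is covered, by [P] if it has degree [D] in [H]. *)
have aHP e : #|star a (H :\: P) (a e)| <= D.-1.
  have := covaH e; rewrite (card_starID _ _ P) => le_D.
  have [cov0|] := posnP (cova e); last by lia.
  case: (ltnP D.-1 #|star a H (a e)|) => [full|]; last first.
    by rewrite (card_starID _ _ P); lia.
  have [f||f fS cf] := card_star_full (k := D.-1) (c := c1) _ _ full.
  - by move=> g fH gH; apply: (proper_on_eqa c1P).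
  - by move=> f /c1D; lia.
  suff: 0 < #|star a (H :&: P) (a e)| by lia.
  apply/card_gt0P; exists f; move: fS; rewrite !inE => /andP[fM /eqP af].
  by rewrite fM cf /cova af -/(cova e) cov0 !eqxx.
have bHP e : #|star b (H :\: P) (b e)| <= D.-1.
  have := covbH e; rewrite (card_starID _ _ P) => le_D.
  have [cov0|] := posnP (covb e); last by lia.
  case: (ltnP D.-1 #|star b H (b e)|) => [full|]; last first.
    by rewrite (card_starID _ _ P); lia.
  have [f||f fS cf] := card_star_full (k := D.-1) (c := c1) _ _ full.
  - by move=> g fH gH; apply: (proper_on_eqb c1P).
  - by move=> f /c1D; lia.
  suff: 0 < #|star b (H :&: P) (b e)| by lia.
  apply/card_gt0P; exists f; move: fS; rewrite !inE => /andP[fM /eqP bf].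
  by rewrite fM cf /covb bf -/(covb e) cov0 !eqxx orbT.
have [|| c2 c2P c2D] := @konig_edge_colouring D.-1 (H :\: P).
- by move=> e _; apply: aHP.
- by move=> e _; apply: bHP.
(* An edge of [P] is put first at an end missed by [M] and last at the other
   end; the remaining edges are ordered by [c2] in opposite ways at both ends. *)
pose ra e := if e \in P then (if cova e == 0 then 0 else D.+1) else (c2 e).+1.
pose rb e := if e \in P then (if cova e == 0 then D.+1 else 0) else D.-1 - c2 e.
(* Ranks outside [P] therefore lie between [1] and [D.-1], strictly between the extreme ranks [0]
   and [D.+1]. *)
have c2H e : e \in H -> e \notin P -> c2 e < D.-1.
  by move=> eH eP; apply: c2D; rewrite inE eP.
have sH : strict_on ra rb H.
  split=> e f eH fH efE; rewrite /ra /rb;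
    have [eP|eP] := boolP (e \in P); have [fP|fP] := boolP (f \in P).
  - by move=> _; apply: Pa.
  - by have := c2H _ fH fP; case: ifP; lia.
  - by have := c2H _ eH eP; case: ifP; lia.
  - by case=> ?; apply: (proper_on_eqa c2P); rewrite // inE ?eP ?fP.
  - by move=> _; apply: Pb.
  - by have := c2H _ fH fP; case: ifP; lia.
  - by have := c2H _ eH eP; case: ifP; lia.
  - have := c2H _ eH eP; have := c2H _ fH fP => ? ? ?.
    by apply: (proper_on_eqb c2P); rewrite ?in_setD ?eP ?fP //; lia.
pose L e := ~: (p @: star a M (a e) :|: p @: star b M (b e)).
have cardL e : D < #|L e| + cova e + covb e.
  have := cardsC (p @: star a M (a e) :|: p @: star b M (b e)).
  rewrite card_ord -/(L e) cardsU.
  have := leq_imset_card p (star a M (a e)).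
  have := leq_imset_card p (star b M (b e)).
  by rewrite -/(cova e) -/(covb e); lia.
have covle1 (W : eqType) (h : E -> W) w :
    (forall e f, e != f -> h e = h f -> adj e f) -> #|star h M w| <= 1.
  move=> hadj; apply/card_le1_eqP => e f; rewrite !inE.
  move=> /andP[eM /eqP he] /andP[fM /eqP hf]; apply/eqP; apply: contraT => ef.
  by have := MP f e fM eM; rewrite hadj // hf.
have cova1 e : cova e <= 1.
  by apply: covle1 => f g fg fgE; rewrite /adj fg fgE eqxx.
have covb1 e : covb e <= 1.
  by apply: covle1 => f g fg fgE; rewrite /adj fg fgE eqxx orbT.
pose Ra e := [set f in star a H (a e) | ra f < ra e].
pose Rb e := [set f in star b H (b e) | rb f < rb e].
have domE e : #|[set f in H | dominates ra rb f e]| <= #|Ra e| + #|Rb e|.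
  apply: leq_trans (leq_card_setU _ _); apply/subset_leq_card/subsetP => f.
  by rewrite !inE -!andbA -andb_orr.
have RaH e : e \in H -> #|Ra e| < #|star a H (a e)|.
  move=> eH; apply/proper_card/properP; split.
    by apply/subsetP => f; rewrite inE => /andP[].
  by exists e; [apply: mem_star | rewrite !inE ltnn andbF].
have RbH e : e \in H -> #|Rb e| < #|star b H (b e)|.
  move=> eH; apply/proper_card/properP; split.
    by apply/subsetP => f; rewrite inE => /andP[].
  by exists e; [apply: mem_star | rewrite !inE ltnn andbF].
have [|c cP cL] := @list_colouring ra rb _ ord0 H L sH.
  move=> e eH; have le_dom := domE e; have le_L := cardL e.
  have := covaH e; have := covbH e; have := RaH e eH; have := RbH e eH.
  have [eP|eP] := boolP (e \in P).
    (* Nothing precedes [e] at its chosen uncovered end; at the other end fewer edges precede it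
       than its degree in [H], which is at most [D] minus the cover there. *)
    have [_ _ ecov] := PP _ eP.
    have [cov0|cov1] := eqVneq (cova e) 0.
      have : #|Ra e| = 0.
        by apply: eq_card0 => f; rewrite !inE {2}/ra eP cov0 eqxx ltn0 andbF.
      by lia.
    have : #|Rb e| = 0.
      by apply: eq_card0 => f; rewrite !inE {2}/rb eP (negPf cov1) ltn0 andbF.
    by lia.
  have e2 := c2H _ eH eP.
  (* At a covered end no edge of [P] takes rank [0], which makes up for the colour lost to [M]. The
     two bounds add up to [D - cova e - covb e]. *)
  have : #|Ra e| <= (c2 e).+1 - cova e.
    apply: (@card_le_range _ _ ra) => [f g|f].
      rewrite !inE => /andP[/andP[fH /eqP af] _] /andP[/andP[gH /eqP ag] _].
      by apply: sH.1; rewrite ?inE // af ag.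
    rewrite !inE {2}/ra (negPf eP) => /andP[/andP[fH /eqP af] ->]; rewrite andbT.
    rewrite /ra; have := cova1 e; rewrite /cova -af -/(cova f).
    by case: ifP; [case: eqP; lia | lia].
  have : #|Rb e| <= (D.-1 - c2 e) - covb e.
    apply: (@card_le_range _ _ rb) => [f g|f].
      rewrite !inE => /andP[/andP[fH /eqP bf] _] /andP[/andP[gH /eqP bg] _].
      by apply: sH.2; rewrite ?inE // bf bg.
    rewrite !inE {2}/rb (negPf eP) => /andP[/andP[fM /eqP bf] ->]; rewrite andbT.
    have fH : f \in H by rewrite inE.
    rewrite /rb; have := covb1 e; rewrite /covb -bf -/(covb f).
    case: ifPn => [/PP[_ _ fcov]|/(c2H _ fH)]; last by lia.
    by case: eqP; lia.
  by have := cova1 e; have := covb1 e; lia.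
exists (fun e => if e \in M then p e else c e); last by move=> e ->.
have new e f : e \in M -> f \notin M -> adj e f -> p e != c f.
  move=> eM fM /andP[_ ends]; have fH : f \in H by rewrite inE.
  have := cL f fH; rewrite !inE negb_or => /andP[/imsetP nota /imsetP notb].
  apply/eqP => pe; case/orP: ends => /eqP ends.
    by case: nota; exists e; rewrite // inE eM ends eqxx.
  by case: notb; exists e; rewrite // inE eM ends eqxx.
move=> e f _ _ ef; case: ifPn => eM; case: ifPn => fM.
- by have := MP e f eM fM; rewrite ef.
- exact: new.
- by rewrite eq_sym; apply: new; rewrite // adj_sym.
- by apply: cP; rewrite ?inE.
Qed.

End EndMaps.

(** * From end sets to end maps *)

Theorem theorem1p5 (G : multigraph) (hG : bipartite G)
    (M : {set edge G}) (hM : matching M)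
    (pre : {e : edge G | e \in M} -> 'I_(max_degree G).+1) :
  exists c : edge G -> 'I_(max_degree G).+1,
    proper_edge_colouring c /\
    (forall e : {e : edge G | e \in M}, c (val e) = pre e).
Proof.
case: hG => A hA.
have /fin_all_exists[ab abP] : forall e : edge G, exists uv : vertex G * vertex G,
    [/\ uv.1 \in A, uv.2 \notin A & ends e = [set uv.1; uv.2]].
  by move=> e; have [u [v uvP]] := hA e; exists (u, v).
pose a e := (ab e).1; pose b e := (ab e).2.
have adjP e f : reflect (e <> f /\ share_end e f) (adj a b e f).
  have [eA eB eE] := abP e; have [fA fB fE] := abP f.
  apply: (iffP andP) => [[/eqP ef /orP ends]|[ef [v ve vf]]].
    split=> //; case: ends => /eqP vE.
      by exists (a e); rewrite ?eE ?fE !inE /a ?eqxx // -/(a e) vE eqxx.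
    by exists (b e); rewrite ?eE ?fE !inE /b ?eqxx ?orbT // -/(b e) vE eqxx orbT.
  split; first exact/eqP.
  (* A shared end is on the same side for both edges, since [A] separates the values of [a] from
     those of [b]. *)
  move: ve vf; rewrite eE fE !inE => /orP[]/eqP-> /orP[]/eqP vE;
    by rewrite /a /b vE ?eqxx ?orbT //; move: eA eB; rewrite vE ?fA ?(negPf fB).
have degP (h : edge G -> vertex G) e : (forall f, h f \in ends f) ->
    #|star h setT (h e)| <= max_degree G.
  move=> hE; apply: leq_trans (leq_bigmax (h e)).
  by apply/subset_leq_card/subsetP => f; rewrite !inE => /eqP <-.
(* [pre] is made total; the default [ord0] is taken only outside [M]. *)
pose p e := if insub e is Some m then pre m else ord0.
have [|||c cP cp] := @matching_extension_endmaps _ _ _ a b _ M p.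
- by move=> e; apply: degP => f; have [_ _ ->] := abP f; rewrite !inE eqxx.
- by move=> e; apply: degP => f; have [_ _ ->] := abP f; rewrite !inE eqxx orbT.
- by move=> e f eM fM; apply/adjP => -[]; apply: hM.
exists c; split=> [e f ef sef|m]; last by rewrite cp ?(valP m) // /p valK.
by apply/eqP/cP; rewrite ?inE //; apply/adjP.
Qed.
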